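(* Let $G$ be a simple graph and let $e=v_iv_j$ be a pendent edge of $G$ whose vertex $v_j$ is non-pendent (so $d_i=1$ and $d_j\ge 2$). If either (i) $d_{\min}^{(j)}\ge d_j$, or (ii) $\dfrac{\sqrt{d_{\max}^{(j)}}}{2\sqrt{d_j-\frac12+6d_{\max}^{(j)}}}\le \dfrac{\sqrt{d_j}}{d_j+1}$, then $GA(G)>GA(G-e)$.
   Context: $d_k$ denotes the degree of vertex $v_k$ in $G$, and $N(v)$ the neighbourhood of $v$. A pendent vertex has degree $1$; a pendent edge is an edge with a pendent end vertex. $d_{\min}^{(j)}=\min\{d_k : v_k\in N(v_j)\setminus\{v_i\}\}$ and $d_{\max}^{(j)}=\max\{d_k : v_k\in N(v_j)\setminus\{v_i\}\}$ (degrees in $G$). The first geometric-arithmetic index is $GA(H)=\sum_{uv\in E(H)}\frac{2\sqrt{d_H(u)d_H(v)}}{d_H(u)+d_H(v)}$, with degrees taken in $H$; $G-e$ is $G$ with edge $e$ deleted. *)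

(* Defs.v *)
From mathcomp Require Import all_boot all_order all_algebra.

Set Implicit Arguments.
Unset Strict Implicit.
Unset Printing Implicit Defensive.

Import Order.TTheory GRing.Theory Num.Theory.
Local Open Scope ring_scope.

Record sgraph (T : finType) := SGraph {
  adj : rel T;
  adj_sym : symmetric adj;
  adj_irr : irreflexive adj
}.

Definition neigh (T : finType) (G : sgraph T) (v : T) : {set T} :=
  [set u | adj G v u].

Definition deg (T : finType) (G : sgraph T) (v : T) : nat := #|neigh G v|.

Definition edges (T : finType) (G : sgraph T) : {set {set T}} :=
  [set [set p.1; p.2] | p in [set p : T * T | adj G p.1 p.2]].

Definition pendent (T : finType) (G : sgraph T) (v : T) : bool :=
  deg G v == 1%N.

Definition pendent_edge (T : finType) (G : sgraph T) (u v : T) : bool :=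
  ([set u; v] \in edges G) && (pendent G u || pendent G v).

Definition del_rel (T : finType) (G : sgraph T) (e : {set T}) : rel T :=
  [rel x y | adj G x y && ([set x; y] != e)].

Lemma del_sym (T : finType) (G : sgraph T) (e : {set T}) :
  symmetric (del_rel G e).
Proof. by move=> x y; rewrite /del_rel /= adj_sym setUC. Qed.

Lemma del_irr (T : finType) (G : sgraph T) (e : {set T}) :
  irreflexive (del_rel G e).
Proof. by move=> x; rewrite /del_rel /= adj_irr. Qed.

(* All vertices are kept, in particular those that become isolated. *)
Definition del_edge (T : finType) (G : sgraph T) (e : {set T}) : sgraph T :=
  SGraph (@del_sym T G e) (@del_irr T G e).

(* The default value #|T| exceeds every degree, so it does not affect the
   minimum as soon as N(v_j) \ {v_i} is nonempty. *)
Definition dmin (T : finType) (G : sgraph T) (i j : T) : nat :=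
  \big[minn/#|T|]_(k in neigh G j :\ i) deg G k.

Definition dmax (T : finType) (G : sgraph T) (i j : T) : nat :=
  \max_(k in neigh G j :\ i) deg G k.

(* The product and sum run over the two ends of the edge f; see ga_termE. *)
Definition ga_term (R : rcfType) (T : finType) (G : sgraph T) (f : {set T}) : R :=
  2 * Num.sqrt (\prod_(u in f) (deg G u)%:R) / \sum_(u in f) (deg G u)%:R.

Lemma ga_termE (R : rcfType) (T : finType) (G : sgraph T) (u v : T) :
  adj G u v ->
  ga_term R G [set u; v] =
    2 * Num.sqrt ((deg G u)%:R * (deg G v)%:R) / ((deg G u)%:R + (deg G v)%:R).
Proof.
move=> uv; have uNv : u \notin [set v].
  by rewrite inE; apply: contraTneq uv => ->; rewrite adj_irr.
by rewrite /ga_term !big_setU1 // !big_set1.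
Qed.

Definition GA (R : rcfType) (T : finType) (G : sgraph T) : R :=
  \sum_(f in edges G) ga_term R G f.

(* Main.v *)
(* Write f(a, x) = 2 sqrt(a x) / (a + x) and d = deg j. Deleting the edge ij
   removes the term f(1, d) and replaces f(d, x) by f(d - 1, x) for every other
   neighbour of j, x being its degree. Under (i), x >= d and f(-, x) is
   nondecreasing on ]0, x], so no term gets larger. Under (ii), with n = d - 1
   the number of other neighbours, each increase f(n, x) - f(n + 1, x) is less
   than (1 / n) sqrt x / sqrt(n + 1/2 + 6 x); the right-hand side is increasing
   in x, so the n increases together stay below f(1, d). *)

Require Import Defs.
From mathcomp Require Import all_boot all_order all_algebra.
From mathcomp Require Import ring lra.
Set Implicit Arguments.
Unset Strict Implicit.
Unset Printing Implicit Defensive.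

Import Order.TTheory GRing.Theory Num.Theory.
Local Open Scope ring_scope.

(** * Estimates for the weight of an edge as a function of its end degrees *)

Section GaWeight.

Variable R : rcfType.
Implicit Types a b n x y p q c : R.

Definition ga_weight x y : R := 2 * Num.sqrt (x * y) / (x + y).

(** With squares as arguments the roots disappear, and the sign of the difference is that of
    [(q - p) * (c ^+ 2 - p * q)]. *)
Lemma ga_weight_sub p q c : 0 < p -> 0 < q -> 0 < c ->
  ga_weight (q ^+ 2) (c ^+ 2) - ga_weight (p ^+ 2) (c ^+ 2) =
    2 * c * (q - p) * (c ^+ 2 - p * q)
    / ((p ^+ 2 + c ^+ 2) * (q ^+ 2 + c ^+ 2)).
Proof.
move=> p0 q0 c0.
have p2 : 0 < p ^+ 2 + c ^+ 2 by rewrite addr_gt0 ?exprn_gt0.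
have q2 : 0 < q ^+ 2 + c ^+ 2 by rewrite addr_gt0 ?exprn_gt0.
rewrite /ga_weight -!exprMn !sqrtr_sqr !ger0_norm; last 2 first.
- by rewrite mulr_ge0 ?ltW.
- by rewrite mulr_ge0 ?ltW.
by field; rewrite !gt_eqF.
Qed.

Lemma ga_weight_homo a b x : 0 < a -> a <= b -> b <= x ->
  ga_weight a x <= ga_weight b x.
Proof.
move=> a0 ab bx; have b0 := lt_le_trans a0 ab; have x0 := lt_le_trans b0 bx.
rewrite -subr_ge0 -(sqr_sqrtr (ltW a0)) -(sqr_sqrtr (ltW b0)).
rewrite -(sqr_sqrtr (ltW x0)) ga_weight_sub ?sqrtr_gt0 //.
have sab : Num.sqrt a <= Num.sqrt b by rewrite ler_wsqrtr.
have sbx : Num.sqrt b <= Num.sqrt x by rewrite ler_wsqrtr.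
apply: divr_ge0; last by rewrite mulr_ge0 // addr_ge0 ?sqr_ge0.
rewrite !mulr_ge0 ?sqrtr_ge0 ?subr_ge0 // expr2.
by rewrite ler_pM ?sqrtr_ge0 // (le_trans sab).
Qed.

(** This is what squaring leaves of [ga_weight_drop] once [sqrt (n (n + 1))] is replaced by rational
    bounds. *)
Lemma ga_weight_poly_bound n x : 0 < n -> 0 <= x ->
  n ^+ 2 * (n + 2^-1 - x) ^+ 2 * (n + 2^-1 + 6 * x)
  < (n + 4^-1) * ((n + x) * (n + 1 + x)) ^+ 2.
Proof.
move=> n0 x0; rewrite -subr_gt0.
have n2 : 0 < n ^+ 2 by rewrite exprn_gt0.
(* Apart from the square (n - x)^2 all coefficients are nonnegative. *)
have -> : (n + 4^-1) * ((n + x) * (n + 1 + x)) ^+ 2 -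
    n ^+ 2 * (n + 2^-1 - x) ^+ 2 * (n + 2^-1 + 6 * x) =
  n ^+ 2 / 8 + (n * x ^+ 2 * (16 * n ^+ 2 + (n - x) ^+ 2) +
  (3 / 4 * n ^+ 4 + 3 * n ^+ 3 * x + 13 * n ^+ 2 * x ^+ 2 + 3 * n * x ^+ 3 +
   x ^+ 4 / 4 + 3 / 4 * n ^+ 3 + 5 / 2 * n ^+ 2 * x + 5 / 2 * n * x ^+ 2 +
   x ^+ 3 / 2 + n * x / 2 + x ^+ 2 / 4)) by field.
(* The separate summand [n ^+ 2 / 8] gives strictness. *)
apply: ltr_wpDr; last by rewrite divr_gt0.
have n0' := ltW n0.
by repeat first [exact: ler0n | assumption | apply: sqr_ge0 | apply: exprn_ge0
  | apply: addr_ge0 | rewrite invr_ge0 | apply: mulr_ge0].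
Qed.

Lemma ga_weight_drop n x : 0 < n -> 0 < x ->
  n * (ga_weight n x - ga_weight (n + 1) x)
  < Num.sqrt x / Num.sqrt (n + 2^-1 + 6 * x).
Proof.
move=> n0 x0; have n10 : 0 < n + 1 by rewrite addr_gt0.
have A0 : 0 < n + 2^-1 + 6 * x by rewrite !addr_gt0 ?mulr_gt0 ?invr_gt0.
set p := Num.sqrt n; set q := Num.sqrt (n + 1); set c := Num.sqrt x.
set r := Num.sqrt (n + 2^-1 + 6 * x); set D := (n + x) * (n + 1 + x).
have p0 : 0 < p by rewrite sqrtr_gt0.
have q0 : 0 < q by rewrite sqrtr_gt0.
have c0 : 0 < c by rewrite sqrtr_gt0.
have r0 : 0 < r by rewrite sqrtr_gt0.
have D0 : 0 < D by rewrite mulr_gt0 ?addr_gt0.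
have p2 : p ^+ 2 = n by rewrite sqr_sqrtr ?ltW.
have q2 : q ^+ 2 = n + 1 by rewrite sqr_sqrtr ?ltW.
have c2 : c ^+ 2 = x by rewrite sqr_sqrtr ?ltW.
have r2 : r ^+ 2 = n + 2^-1 + 6 * x by rewrite sqr_sqrtr ?ltW.
have pq : p < q by rewrite ltr_sqrt // ltrDl.
have -> : ga_weight n x - ga_weight (n + 1) x =
    2 * c * (q - p) * (p * q - x) / D.
  rewrite -opprB -{1 2}c2 -{1}q2 -{1}p2 ga_weight_sub // p2 q2 c2 -/D.
  by rewrite -mulNr -mulrN opprB.
(* If [p * q <= x], the left side is nonpositive; only the other case needs an estimate. *)
have [pqx|xpq] := leP (p * q) x.
  apply: (@le_lt_trans _ _ 0); last by rewrite divr_gt0.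
  apply: mulr_ge0_le0; first exact: ltW.
  apply: mulr_le0_ge0; last by rewrite invr_ge0 ltW.
  apply: mulr_ge0_le0; last by rewrite subr_le0.
  by rewrite !mulr_ge0 ?subr_ge0 ?ltW.
rewrite mulrA ltr_pdivrMr // [c / r * D]mulrAC ltr_pdivlMr //.
(* Multiplying by q + p removes q - p, as q^2 - p^2 = 1. *)
rewrite -(ltr_pM2r (addr_gt0 q0 p0)).
have -> : n * (2 * c * (q - p) * (p * q - x)) * r * (q + p) =
    c * (2 * n * (p * q - x) * r).
  transitivity (c * (2 * n * (p * q - x) * r) * (q ^+ 2 - p ^+ 2)).
    by ring.
  by rewrite q2 p2 addrAC subrr add0r mulr1.
rewrite -[c * D * _]mulrA ltr_pM2l //.
(* After squaring, sqrt(n (n + 1)) is bounded below by n in (q + p)^2 and above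
   by n + 1/2 in (p q - x)^2. *)
have npq : n <= p * q by rewrite -p2 expr2 ler_pM2l // ltW.
have pqn : p * q <= n + 2^-1.
  have := sqr_ge0 (q - p); rewrite sqrrB q2 p2; lra.
have xr : 0 <= p * q - x by rewrite subr_ge0 ltW.
rewrite -ltr_sqr ?nnegrE; last 2 first.
- by rewrite !mulr_ge0 // ltW.
- by rewrite mulr_ge0 ?addr_ge0 // ltW.
have -> : (2 * n * (p * q - x) * r) ^+ 2 =
    4 * (n ^+ 2 * (p * q - x) ^+ 2 * (n + 2^-1 + 6 * x)).
  by rewrite -r2; ring.
have -> : (D * (q + p)) ^+ 2 = 4 * ((n / 2 + 4^-1 + p * q / 2) * D ^+ 2).
  transitivity (D ^+ 2 * (q ^+ 2 + p ^+ 2 + 2 * (p * q))); first by ring.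
  by rewrite q2 p2; field.
rewrite ltr_pM2l //.
apply: (@le_lt_trans _ _
    (n ^+ 2 * (n + 2^-1 - x) ^+ 2 * (n + 2^-1 + 6 * x))).
  rewrite ler_pM2r // ler_pM2l ?exprn_gt0 //.
  by rewrite ler_sqr ?nnegrE //; lra.
apply: (lt_le_trans (ga_weight_poly_bound n0 (ltW x0))).
by rewrite -/D ler_pM2r ?exprn_gt0 //; lra.
Qed.

(** Cross-multiplying and merging the roots leaves [x * a <= y * a], as the terms [6 * x * y]
    cancel. *)
Lemma ratio_sqrt_homo a x y : 0 < a -> 0 < x -> x <= y ->
  Num.sqrt x / Num.sqrt (a + 6 * x) <= Num.sqrt y / Num.sqrt (a + 6 * y).
Proof.
move=> a0 x0 xy; have y0 := lt_le_trans x0 xy.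
have X0 : 0 < a + 6 * x by rewrite addr_gt0 ?mulr_gt0.
have Y0 : 0 < a + 6 * y by rewrite addr_gt0 ?mulr_gt0.
rewrite ler_pdivrMr ?sqrtr_gt0 // mulrAC ler_pdivlMr ?sqrtr_gt0 //.
rewrite -(sqrtrM _ (ltW x0)) -(sqrtrM _ (ltW y0)) ler_wsqrtr //.
rewrite !mulrDr (mulrCA x) (mulrCA y) (mulrC y x).
by rewrite lerD2r ler_pM2r.
Qed.

End GaWeight.

(** * The effect of deleting an edge on degrees and on the index *)

Section EdgeDeletion.

Variables (T : finType) (G : sgraph T).
Implicit Types (u v i j : T).

Lemma mem_edges u v : ([set u; v] \in edges G) = adj G u v.
Proof.
apply/imsetP/idP => [[[a b]]|uv]; last by exists (u, v); rewrite ?inE.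
rewrite inE /= => ab E.
have := set21 u v; have := set22 u v; rewrite E => /set2P v_ab /set2P u_ab.
have := set21 a b; have := set22 a b; rewrite -E => /set2P b_uv /set2P a_uv.
case: u_ab v_ab a_uv b_uv => -> [] -> [] ? [] ?; subst;
  by rewrite // 1?adj_sym // adj_irr in ab *.
Qed.

Lemma edges_del_edge (e : {set T}) : edges (del_edge G e) = edges G :\ e.
Proof.
apply/setP=> f; rewrite 2!inE; apply/imsetP/andP => [[[a b]]|[fe]].
  by rewrite inE /= => /andP[ab abe] ->; rewrite abe mem_edges.
case/imsetP=> [[a b]]; rewrite inE /= => ab fE.
by exists (a, b); rewrite // inE /= /del_rel /= ab -fE.
Qed.

Lemma neigh_del_edge_end i j : neigh (del_edge G [set i; j]) j = neigh G j :\ i.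
Proof.
apply/setP=> u; rewrite !inE /= /del_rel /= [RHS]andbC.
case: (boolP (adj G j u)) => //= ju; congr negb.
apply/eqP/eqP => [|->]; last exact: setUC.
have := set22 j u => /[swap] -> /set2P[] // uj.
by rewrite uj adj_irr in ju.
Qed.

Lemma deg_del_edge_end i j : adj G i j ->
  deg G j = (deg (del_edge G [set i; j]) j).+1.
Proof.
move=> ij; rewrite /deg neigh_del_edge_end (cardsD1 i (neigh G j)).
by rewrite inE adj_sym ij.
Qed.

Lemma deg_del_edge_other i j v : v != i -> v != j ->
  deg (del_edge G [set i; j]) v = deg G v.
Proof.
move=> vi vj; apply: eq_card => u; rewrite !inE /= /del_rel /=.
case: (adj G v u) => //=; apply/eqP => E.
by have := set21 v u; rewrite E !inE (negPf vi) (negPf vj).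
Qed.

Lemma pendent_neigh i j u : pendent G i -> adj G i j -> adj G i u -> u = j.
Proof.
move=> /cards1P[w nE] ij iu.
have : j \in neigh G i by rewrite inE.
have : u \in neigh G i by rewrite inE.
by rewrite nE => /set1P -> /set1P.
Qed.

(** The edge [ij] is the only one at [i]; hence an edge avoiding [j] avoids [i] too, and deletion
    changes neither of its end degrees. *)
Lemma pendent_edge_mem i j (f : {set T}) : pendent G i -> adj G i j ->
  f \in edges G -> i \in f -> j \in f.
Proof.
move=> pi ij /imsetP[[a b]]; rewrite inE /= => ab -> /set2P[] E.
  by rewrite -E in ab *; rewrite (pendent_neigh pi ij ab) set22.
by rewrite -E adj_sym in ab *; rewrite (pendent_neigh pi ij ab) set21.
Qed.

Lemma GA_pendent_del (R : rcfType) i j : pendent G i -> adj G i j ->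
  GA R G = GA R (del_edge G [set i; j]) + (ga_weight 1 (deg G j)%:R +
    \sum_(k in neigh G j :\ i)
      (ga_weight (deg G j)%:R (deg G k)%:R -
       ga_weight (deg (del_edge G [set i; j]) j)%:R (deg G k)%:R)).
Proof.
move=> pi ij; set G' := del_edge G _; set e := [set i; j].
have eE : e \in edges G by rewrite mem_edges.
rewrite /GA (big_setD1 e eE) /= ga_termE // (eqP pi) -/(ga_weight _ _).
rewrite [RHS]addrCA; congr (_ + _).
rewrite edges_del_edge -/e; apply/eqP; rewrite addrC -subr_eq -sumrB; apply/eqP.
(* Both sums now run over the edges other than [e]. Those avoiding [j] cancel; those through [j] are
   reindexed by their other end [k], whose degree is unchanged. *)
rewrite (bigID (fun f : {set T} => j \in f)) /= [X in _ + X]big1 ?addr0; last first.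
  move=> f; rewrite in_setD1 => /andP[/andP[_ fE] jf].
  apply/eqP; rewrite subr_eq0 /ga_term; apply/eqP.
  have degE u : u \in f -> (deg G u)%:R = (deg G' u)%:R :> R.
    move=> uf; rewrite deg_del_edge_other //; apply: contraNneq jf => uE.
      by rewrite (pendent_edge_mem pi ij fE) // -uE.
    by rewrite -uE.
  by rewrite (eq_bigr _ degE) [in X in _ / X](eq_bigr _ degE).
have injk : {in neigh G j :\ i &, injective (fun k => [set j; k])}.
  move=> k l; rewrite !inE => /andP[_ jk] _ E.
  have := set22 j k; rewrite E => /set2P[] // kj.
  by rewrite kj adj_irr in jk.
rewrite (eq_bigl (fun f => f \in [set [set j; k] | k in neigh G j :\ i])).
  rewrite (big_imset _ injk); apply: eq_bigr => k.
  rewrite -neigh_del_edge_end inE => jk.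
  have kj : k != j by apply: contraTneq jk => ->; rewrite adj_irr.
  have [jkG ki] : adj G j k /\ k != i.
    have : k \in neigh G j :\ i by rewrite -neigh_del_edge_end inE.
    by rewrite !inE => /andP[].
  by rewrite !ga_termE // -!/(ga_weight _ _) (deg_del_edge_other ki kj).
move=> f; rewrite in_setD1; apply/idP/imsetP => [|[k]].
  move=> /andP[/andP[fe /imsetP[[a b]]]]; rewrite inE /= => ab fE.
  move: fe; rewrite fE => abe /set2P[] jE; subst.
    exists b => //; rewrite !inE ab andbT.
    by apply: contraNneq abe => ->; rewrite setUC.
  exists a; last by rewrite setUC.
  by rewrite !inE adj_sym ab andbT; apply: contraNneq abe => ->.
rewrite !inE => /andP[ki jk] ->; rewrite mem_edges jk set21 !andbT.
apply: contraNneq ki => E; have := set22 j k; rewrite E => /set2P[->//|kj].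
by rewrite kj adj_irr in jk.
Qed.

End EdgeDeletion.

Theorem theorem12 (R : rcfType) (T : finType) (G : sgraph T) (i j : T)
  (he : pendent_edge G i j) (hj : ~~ pendent G j)
  (hcond :
     (deg G j <= dmin G i j)%N \/
     Num.sqrt ((dmax G i j)%:R : R) /
       (2 * Num.sqrt ((deg G j)%:R - 1 / 2 + 6 * (dmax G i j)%:R))
     <= Num.sqrt ((deg G j)%:R) / ((deg G j)%:R + 1)) :
  GA R (del_edge G [set i; j]) < GA R G.
Proof.
move: he; rewrite /pendent_edge mem_edges (negPf hj) orbF => /andP[ij pi].
rewrite (GA_pendent_del R pi ij) ltrDl.
(* [n] is both [deg G j - 1] and the number of neighbours of [j] other than [i]. *)
have dj := deg_del_edge_end ij; set n := deg (del_edge _ _) j in dj *.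
have nE : n = #|neigh G j :\ i| by rewrite /n /deg neigh_del_edge_end.
have n0 : (0 < n)%N.
  by rewrite lt0n; apply: contraNneq hj => n0; rewrite /pendent dj n0.
have nR0 : 0 < n%:R :> R by rewrite ltr0n.
have w0 : 0 < ga_weight 1 (deg G j)%:R :> R.
  by rewrite divr_gt0 ?addr_gt0 ?mulr_gt0 ?sqrtr_gt0 ?mul1r ?ltr0n ?dj.
have degk k : k \in neigh G j :\ i -> (0 < deg G k)%N.
  rewrite !inE => /andP[_ jk]; rewrite card_gt0; apply/set0Pn; exists j.
  by rewrite inE adj_sym.
case: hcond => [hmin|hmax].
  apply: ltr_wpDr w0; apply: sumr_ge0 => k kj.
  rewrite subr_ge0 ga_weight_homo // ler_nat ?dj ?leqnSn // -dj.
  (* The minimum is at most its entry at [k], whatever the default value. *)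
  apply: leq_trans hmin _; rewrite /dmin -minEnat -leEnat.
  exact: bigmin_le_cond.
rewrite -ltrBlDr sub0r -sumrN.
have [k0 k0j] : exists k, k \in neigh G j :\ i.
  by apply/set0Pn; rewrite -card_gt0 -nE.
have M0 : (0 < dmax G i j)%N.
  by apply: leq_trans (degk k0 k0j) _; exact: leq_bigmax_cond.
set w := ga_weight 1 _.
(* Twice condition (ii): [deg G j - 1 / 2] is [n + 1 / 2], and [w] is [2 sqrt d / (d + 1)] with
   [d = deg G j]. *)
have hw : Num.sqrt (dmax G i j)%:R / Num.sqrt (n%:R + 2^-1 + 6 * (dmax G i j)%:R)
    <= w.
  have -> : n%:R + 2^-1 = (deg G j)%:R - 1 / 2 :> R by rewrite dj -natr1; field.
  have -> : w = 2 * (Num.sqrt (deg G j)%:R / ((deg G j)%:R + 1)).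
    by rewrite /w /ga_weight mul1r mulrA addrC.
  rewrite -ler_pdivrMl // mulrCA -invfM; exact: hmax.
(* Split [w] into [n] equal shares; each neighbour's increase stays strictly below one share, and
   [k0] makes the sum nonempty, so strictness survives. *)
apply: (@lt_le_trans _ _ (\sum_(k in neigh G j :\ i) (w / n%:R))); last first.
  by rewrite sumr_const -nE -(mulr_natr (w / _)) mulfVK ?gt_eqF.
apply: ltr_sum => [|k kj]; first by apply/hasP; exists k0; rewrite ?mem_index_enum.
rewrite opprB ltr_pdivlMr // mulrC dj -natr1.
apply: lt_le_trans (ga_weight_drop nR0 _) _; first by rewrite ltr0n degk.
apply: le_trans hw; apply: ratio_sqrt_homo.
- by rewrite addr_gt0 ?invr_gt0.
- by rewrite ltr0n degk.
- by rewrite ler_nat; exact: leq_bigmax_cond.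
Qed.
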